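(* Let $p$ be a prime number and $k\ge 1$. Assume that for all integers $1\le m<k$ there is an equational proof of the constructive Wedderburn Theorem $W_{p,k,T^{p^m}}$. Then there is an equational proof that every $p^k$-ring with $p=0$ is commutative. The same conclusion holds when there are equational proofs of $W_{p,k,f}$ for all polynomials $f\in\mathbb{F}_p[T]$ of degree $<k$.
   Context: Rings are associative and unital, not necessarily commutative; the zero ring is allowed. For an integer $n>1$, an $n$-ring is a ring in which $x^n=x$ holds for every element $x$. Constructive Wedderburn Theorem. For a prime $p$, $k\ge 1$ and $f\in\mathbb{F}_p[T]$, $W_{p,k,f}$ is the statement: if $A$ is a $p^k$-ring with $p=0$ and $a,b\in A$ satisfy $ba=f(a)b$, then $ba=ab$. Equational proofs. An algebraic theory $\mathcal{T}$ is given by operation symbols of finite arities and a set of axioms, each an equation between terms. An equational proof of $\sigma=\tau$ in $\mathcal{T}$ (written $\mathcal{T}\vdash\sigma=\tau$) is a deduction by the rules: (1) if $\sigma=\tau$ is an axiom then $\mathcal{T}\vdash\sigma=\tau$; (2) $\mathcal{T}\vdash\sigma=\sigma$; (3) if $\mathcal{T}\vdash\sigma=\tau$ then $\mathcal{T}\vdash\tau=\sigma$; (4) if $\mathcal{T}\vdash\sigma=\tau$ and $\mathcal{T}\vdash\tau=\rho$ then $\mathcal{T}\vdash\sigma=\rho$; (5) if $\rho$ is a term of arity $r$ and $\mathcal{T}\vdash\sigma_i=\tau_i$ for $i=1,\dots,r$, then $\mathcal{T}\vdash\rho(\sigma_1,\dots,\sigma_r)=\rho(\tau_1,\dots,\tau_r)$;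 (6) if $\sigma,\tau$ are terms of arity $r$ with $\mathcal{T}\vdash\sigma=\tau$, then $\mathcal{T}\vdash\sigma(\rho_1,\dots,\rho_r)=\tau(\rho_1,\dots,\rho_r)$ for all terms $\rho_1,\dots,\rho_r$. The theory of $p^k$-rings with $p=0$ consists of the ring axioms (operations $+,-,0,\cdot,1$) together with the axioms $x^{p^k}=x$ and $p\cdot 1=0$. ''There is an equational proof that every such ring is commutative'' means that this theory proves $xy=yx$ for two distinct variables $x,y$. An equational proof of $W_{p,k,f}$ means an equational proof of $ba=ab$ in the theory of $p^k$-rings with $p=0$ extended by two constant symbols $a,b$ and the axiom $ba=f(a)b$. *)

(* Defs.v *)
From mathcomp Require Import all_boot all_order all_algebra.

Set Implicit Arguments.
Unset Strict Implicit.
Unset Printing Implicit Defensive.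

Import GRing.Theory.

(** * Algebraic theories and equational proofs *)

Record signature := Signature { op : Type; arity : op -> nat }.

(** [term S n]: terms of arity [n], with variables indexed by ['I_n]. *)
Inductive term (S : signature) (n : nat) : Type :=
| Var of 'I_n
| App (o : op S) of ('I_(arity o) -> term S n).

Arguments Var {S n}.
Arguments App {S n}.

(** [subst s r] is the composite term s(r_0, ..., r_(n-1)). *)
Fixpoint subst (S : signature) (n m : nat) (s : term S n)
    (r : 'I_n -> term S m) : term S m :=
  match s with
  | Var i => r i
  | App o args => App o (fun i => subst (args i) r)
  end.

Record theory := Theory {
  sig_of : signature;
  axiom : forall n, term sig_of n -> term sig_of n -> Prop
}.

Inductive provable (T : theory) :
    forall n, term (sig_of T) n -> term (sig_of T) n -> Prop :=
| pr_axiom n (s t : term (sig_of T) n) : axiom s t -> provable s t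
| pr_refl n (s : term (sig_of T) n) : provable s s
| pr_sym n (s t : term (sig_of T) n) : provable s t -> provable t s
| pr_trans n (s t u : term (sig_of T) n) :
    provable s t -> provable t u -> provable s u
| pr_congr r n (u : term (sig_of T) r) (s t : 'I_r -> term (sig_of T) n) :
    (forall i, provable (s i) (t i)) -> provable (subst u s) (subst u t)
| pr_subst r n (s t : term (sig_of T) r) (u : 'I_r -> term (sig_of T) n) :
    provable s t -> provable (subst s u) (subst t u).

(** * Terms in the language of rings *)

(** The ring operations, together with one constant symbol for each element
    of [C]; [C := void] is the plain language of rings. *)
Inductive ring_op (C : Type) : Type :=
| Add | Opp | Zero | Mul | One | Const of C.

Arguments Add {C}.
Arguments Opp {C}.
Arguments Zero {C}.
Arguments Mul {C}.
Arguments One {C}.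

Definition ring_arity (C : Type) (o : ring_op C) : nat :=
  match o with
  | Add | Mul => 2
  | Opp => 1
  | Zero | One | Const _ => 0
  end.

Definition ring_sig (C : Type) : signature := Signature (@ring_arity C).

Section RingTerms.
Variables (C : Type) (n : nat).
Notation tm := (term (ring_sig C) n).

Definition tadd (s t : tm) : tm :=
  @App (ring_sig C) n Add (tnth [tuple s; t]).
Definition topp (s : tm) : tm := @App (ring_sig C) n Opp (tnth [tuple s]).
Definition tzero : tm := @App (ring_sig C) n Zero (tnth [tuple]).
Definition tmul (s t : tm) : tm :=
  @App (ring_sig C) n Mul (tnth [tuple s; t]).
Definition tone : tm := @App (ring_sig C) n One (tnth [tuple]).
Definition tconst (c : C) : tm :=
  @App (ring_sig C) n (Const c) (tnth [tuple]).

Definition tnat (m : nat) : tm := iterop m tadd tone tzero.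
Definition texp (s : tm) (m : nat) : tm := iterop m tmul s tone.

(** f(s), each coefficient c of f being written as c . 1 for its representative
    0 <= c < p. *)
Definition tpoly (p : nat) (f : {poly 'F_p}) (s : tm) : tm :=
  \big[tadd/tzero]_(i < size f) tmul (tnat (f`_i)%R) (texp s i).

End RingTerms.

Arguments tzero {C n}.
Arguments tone {C n}.
Arguments tconst {C n}.
Arguments tnat {C n}.

Declare Scope rterm_scope.
Delimit Scope rterm_scope with rterm.
Bind Scope rterm_scope with term.
Notation "s + t" := (tadd s t) : rterm_scope.
Notation "- s" := (topp s) : rterm_scope.
Notation "s * t" := (tmul s t) : rterm_scope.
Notation "s ^+ m" := (texp s m) : rterm_scope.
Notation "0" := tzero : rterm_scope.
Notation "1" := tone : rterm_scope.

Definition x1 {C} : term (ring_sig C) 1 := Var ord0.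
Definition x2 {C} : term (ring_sig C) 2 := Var (@Ordinal 2 0 isT).
Definition y2 {C} : term (ring_sig C) 2 := Var (@Ordinal 2 1 isT).
Definition x3 {C} : term (ring_sig C) 3 := Var (@Ordinal 3 0 isT).
Definition y3 {C} : term (ring_sig C) 3 := Var (@Ordinal 3 1 isT).
Definition z3 {C} : term (ring_sig C) 3 := Var (@Ordinal 3 2 isT).

(** * The theory of p^k-rings with p = 0 *)

Inductive ring_axiom (C : Type) :
    forall n, term (ring_sig C) n -> term (ring_sig C) n -> Prop :=
| ax_addA : ring_axiom (x3 + (y3 + z3))%rterm ((x3 + y3) + z3)%rterm
| ax_addC : ring_axiom (x2 + y2)%rterm (y2 + x2)%rterm
| ax_add0 : ring_axiom (0 + x1)%rterm x1
| ax_addN : ring_axiom (- x1 + x1)%rterm (0 : term (ring_sig C) 1)%rterm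
| ax_mulA : ring_axiom (x3 * (y3 * z3))%rterm ((x3 * y3) * z3)%rterm
| ax_mul1l : ring_axiom (1 * x1)%rterm x1
| ax_mul1r : ring_axiom (x1 * 1)%rterm x1
| ax_mulDl : ring_axiom ((x3 + y3) * z3)%rterm (x3 * z3 + y3 * z3)%rterm
| ax_mulDr : ring_axiom (x3 * (y3 + z3))%rterm (x3 * y3 + x3 * z3)%rterm.

Inductive pkring_axiom (C : Type) (p k : nat) :
    forall n, term (ring_sig C) n -> term (ring_sig C) n -> Prop :=
| ax_ring n (s t : term (ring_sig C) n) :
    ring_axiom s t -> pkring_axiom p k s t
| ax_pow : pkring_axiom p k (x1 ^+ (p ^ k)%N)%rterm x1
| ax_char : pkring_axiom p k (tnat p) (0 : term (ring_sig C) 0)%rterm.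

Definition pkring_theory (p k : nat) : theory :=
  Theory (@pkring_axiom void p k).

Definition commutativity_provable (p k : nat) : Prop :=
  @provable (pkring_theory p k) 2 (x2 * y2)%rterm (y2 * x2)%rterm.

(** * The constructive Wedderburn theorem W_{p,k,f} *)

Inductive W_const := Wa | Wb.

Notation ta := (tconst Wa : term (ring_sig W_const) 0).
Notation tb := (tconst Wb : term (ring_sig W_const) 0).

Inductive W_axiom (p k : nat) (f : {poly 'F_p}) :
    forall n, term (ring_sig W_const) n -> term (ring_sig W_const) n -> Prop :=
| ax_pkring n (s t : term (ring_sig W_const) n) :
    pkring_axiom p k s t -> W_axiom k f s t
| ax_rel : W_axiom k f (tb * ta)%rterm (tpoly f ta * tb)%rterm.

Definition W_theory (p k : nat) (f : {poly 'F_p}) : theory :=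
  Theory (@W_axiom p k f).

Definition W_provable (p k : nat) (f : {poly 'F_p}) : Prop :=
  @provable (W_theory k f) 0 (tb * ta)%rterm (ta * tb)%rterm.

Arguments W_provable : clear implicits.

(* Main.v *)
Require Import Defs.
From mathcomp Require Import all_boot all_order all_algebra all_field.
From HB Require Import structures.
From mathcomp Require Import boolp.

(** Write L and R for left and right multiplication by a, and q = p^k. In a ring
    with x^q = x idempotents are central, hence so is every c with c^p = c. The
    coefficients of h(Y) = (Y - a)(Y - a^p)...(Y - a^(p^(k-1))) are fixed by
    Frobenius, so they are central and the product of the commuting operators
    R - L^(p^m), 0 <= m < k, maps b to b h(a) = 0. On a vector killed by
    R - L^(p^m), the Wedderburn statement for T^(p^m) gives that R - L vanishes;
    since (R - L)^2 x = 0 implies (R - L) x = 0, all the factors with m > 0 can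
    be peeled off, and (R - L) b = 0.

    For polynomials of degree < k, central idempotents split the coefficients of
    h into elements of F_p; on each piece a is a root of a monic polynomial of
    degree k over F_p, modulo which T^(p^m) is some f of degree < k.

    Equational proofs are linked to rings by soundness (for the hypotheses) and
    by the ring of terms in two variables modulo provable equality (for the
    conclusion). *)

Set Implicit Arguments.
Unset Strict Implicit.
Unset Printing Implicit Defensive.

Import GRing.Theory.

Local Open Scope quotient_scope.
Local Open Scope ring_scope.

(** * Rings of characteristic p in which x^(p^k) = x *)

Section PowerRing.
Variables (p k : nat) (A : algType 'F_p).
Hypotheses (p_pr : prime p) (k_gt0 : (0 < k)%N).
Hypothesis powA : forall x : A, x ^+ (p ^ k) = x.
Implicit Types a b c d e x y : A.

Let p_gt1 : (1 < p)%N. Proof. exact: prime_gt1. Qed.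

Let q_gt1 : (1 < p ^ k)%N.
Proof. by rewrite -(exp1n k) ltn_exp2r. Qed.

Lemma pcharA : p \in [pchar A].
Proof. by rewrite (pchar_lalg A) pchar_Fp. Qed.

Lemma square_zero x : x * x = 0 -> x = 0.
Proof.
by move=> xx0; rewrite -(powA x) -(subnKC q_gt1) exprD expr2 xx0 mul0r.
Qed.

(** Both [e * x * e - e * x] and [e * x * e - x * e] square to zero, hence vanish. *)
Lemma idempotent_central e x : e * e = e -> e * x = x * e.
Proof.
move=> ee.
have exe : e * x * e = e * x.
  apply/subr0_eq/square_zero.
  by rewrite mulrBl !mulrBr -!mulrA !(mulrA e e) ee subrr.
rewrite -exe; apply/subr0_eq/square_zero.
by rewrite mulrBl !mulrBr -!mulrA !(mulrA e e) ee !subrr.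
Qed.

(* [1 - d ^+ (p - 1)] is the idempotent of the locus [d = 0]. *)
Lemma fixed_idempotent d (e := 1 - d ^+ p.-1) : d ^+ p = d ->
  [/\ e * e = e, forall x, e * x = x * e & d * e = 0].
Proof.
move=> dp.
have de : d * e = 0.
  by rewrite mulrBr mulr1 -exprS prednK ?prime_gt0 // dp subrr.
have ee : e * e = e.
  rewrite {1}/e mulrBl mul1r.
  rewrite -(prednK (_ : 0 < p.-1)%N) -?subn1 ?subn_gt0 // exprSr -mulrA de.
  by rewrite mulr0 subr0.
by split=> // x; apply: idempotent_central.
Qed.

Lemma fixed_shift c (i : 'F_p) : c ^+ p = c -> (c - i%:A) ^+ p = c - i%:A.
Proof.
move=> cp; rewrite -(pFrobenius_autE pcharA) pFrobenius_autB_comm; last first.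
  by rewrite /GRing.comm mulr_algl mulr_algr.
rewrite !pFrobenius_autE cp exprZn expr1n; congr (c - _ *: _).
by have := expf_card i; rewrite card_Fp.
Qed.

(** Each [(c - i%:A) ^+ p.-1] fixes [y] by hypothesis, and their product over [i] is
    [(c ^+ p - c) ^+ p.-1 = 0]. *)
Lemma fixed_cases c y : c ^+ p = c ->
  (forall i : 'F_p, (1 - (c - i%:A) ^+ p.-1) * y = 0) -> y = 0.
Proof.
move=> cp ey.
have -> : y = horner_alg c (\prod_(i : 'F_p) ('X - i%:P) ^+ p.-1) * y.
  elim/big_rec: _ => [|i f _ IHf]; first by rewrite rmorph1 mul1r.
  rewrite rmorphM /= -mulrA -IHf.
  have -> : horner_alg c (('X - i%:P) ^+ p.-1) = (c - i%:A) ^+ p.-1.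
    by rewrite rmorphXn rmorphB /= horner_algX horner_algC.
  by apply/subr0_eq; rewrite -{1}[y]mul1r -mulrBl.
rewrite prodrXl -finField_genPoly card_Fp // rmorphXn rmorphB rmorphXn.
by rewrite /= horner_algX cp subrr expr0n -subn1 subn_eq0 leqNgt p_gt1 mul0r.
Qed.

(** On the idempotent of the locus [c = i], [c] acts as the scalar [i], so the commutator vanishes
    on every piece. *)
Lemma fixed_central c x : c ^+ p = c -> c * x = x * c.
Proof.
move=> cp; apply/subr0_eq/(fixed_cases cp) => i.
have [_ ec de] := fixed_idempotent (fixed_shift i cp).
set d := c - _ in ec de *; set e := 1 - _ in ec de *.
have -> : c * x - x * c = d * x - x * d.
  rewrite mulrBl mulrBr mulr_algl mulr_algr opprB.
  by rewrite addrA addrNK.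
by rewrite mulrBr !mulrA (ec x) -(mulrA x) (ec d) de mul0r mulr0 subrr.
Qed.

(** * The operators [D m] and the product of their polynomials *)

Section FrobeniusProduct.
Variable a : A.

Let D m b := b * a - a ^+ (p ^ m) * b.

(* The inner variable stands for left multiplication by [a], the outer one for
   right multiplication by [a]. *)
Definition frob_prod s : {poly {poly 'F_p}} :=
  \prod_(m <- s) ('X - ('X^(p ^ m))%:P).

(** Evaluation at [a] puts powers of [a] on the right of [b], while the coefficients act on its
    left. *)
Lemma horner_frob_prod s b :
  (map_poly (horner_alg a) (frob_prod s) * b%:P).[a] = foldr D b s.
Proof.
rewrite /frob_prod; elim: s => [|m s IHs].
  by rewrite big_nil rmorph1 mul1r hornerC.
rewrite big_cons rmorphM rmorphB /= map_polyX map_polyC /= rmorphXn /=.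
rewrite horner_algX -mulrA mulrBl hornerD hornerN hornerCM -commr_polyX hornerMX.
by rewrite IHs.
Qed.

(** Frobenius on the coefficients sends factor [m] to factor [m + 1]. At [a] the new factor [k]
    equals the lost factor [0], because [a ^+ (p ^ k) = a]. *)
Lemma frob_prod_coef_fixed j :
  horner_alg a (frob_prod (iota 0 k))`_j ^+ p =
  horner_alg a (frob_prod (iota 0 k))`_j.
Proof.
have pcharP : p \in [pchar {poly 'F_p}].
  by rewrite (pchar_lalg {poly 'F_p}) pchar_Fp.
have frobH : map_poly (pFrobenius_aut pcharP) (frob_prod (iota 0 k)) =
    frob_prod (iota 1 k).
  rewrite rmorph_prod (iotaDl 1 0) /frob_prod big_map; apply: eq_bigr => m _.
  rewrite rmorphB /= map_polyX map_polyC /= pFrobenius_autE.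
  by rewrite -exprM expnSr.
rewrite -rmorphXn -[_ ^+ p]/(pFrobenius_aut pcharP _) -coef_map frobH.
rewrite -!(coef_map (horner_alg a)); congr (_`_j).
have -> : iota 1 k = iota 1 k.-1 ++ [:: k].
  by rewrite -{1}(prednK k_gt0) -(addn1 k.-1) iotaD add1n prednK.
have -> : iota 0 k = 0%N :: iota 1 k.-1 by rewrite -{1}(prednK k_gt0).
(* Factors are reordered before mapping, while the coefficients still commute. *)
rewrite /frob_prod big_cat big_seq1 big_cons mulrC !rmorphM /=.
suff -> : map_poly (horner_alg a) ('X - ('X^(p ^ k))%:P) =
          map_poly (horner_alg a) ('X - ('X^(p ^ 0))%:P) by [].
rewrite !rmorphB /= !map_polyX !map_polyC /= !rmorphXn /= horner_algX.
by rewrite -!rmorphXn /= powA expr1.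
Qed.

Lemma frob_prod_root : (map_poly (horner_alg a) (frob_prod (iota 0 k))).[a] = 0.
Proof.
(* Evaluating at ['X] over the commutative [{poly 'F_p}] is multiplicative, and there factor [0]
   vanishes. *)
have {2}-> : a = horner_alg a 'X by rewrite horner_algX.
rewrite horner_map -(prednK k_gt0) /frob_prod big_cons hornerM hornerXsubC.
by rewrite expr1 subrr mul0r rmorph0.
Qed.

Lemma frob_prod_annihilates b : foldr D b (iota 0 k) = 0.
Proof.
rewrite -horner_frob_prod.
(* Central coefficients let [b%:P] move to the left, where it factors out of the evaluation. *)
set h := map_poly _ _; have -> : h * b%:P = b%:P * h.
  apply/polyP => j; rewrite coefMC coefCM coef_map /=.
  exact/fixed_central/frob_prod_coef_fixed.
by rewrite hornerCM frob_prod_root mulr0.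
Qed.

(* If [c := b * a - a * b] commutes with [a], then
   [b * a ^+ n - a ^+ n * b = n a ^+ (n - 1) c], which is [0] at [n = p ^ k],
   where [a ^+ n = a]. *)
Lemma inner_derivation_square b : D 0 (D 0 b) = 0 -> D 0 b = 0.
Proof.
rewrite /D expr1; set c := b * a - a * b => /subr0_eq ca.
have bn n : b * a ^+ n = a ^+ n * b + a ^+ n.-1 * c *+ n.
  elim: n => [|n IHn]; first by rewrite mulr1 mul1r addr0.
  rewrite exprSr mulrA IHn mulrDl -mulrA; have -> : b * a = a * b + c.
    by rewrite addrC subrK.
  rewrite mulrDr mulrA -exprSr -addrA; congr (_ + _).
  case: n {IHn} => [|n]; first by rewrite mulr0n mul0r addr0 mulr1n.
  by rewrite mulrnAl -mulrA ca mulrA -exprSr -mulrS.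
have := bn (p ^ k)%N; rewrite powA /c => ->.
rewrite -mulr_natr natrX (pcharf0 pcharA) expr0n gtn_eqF //.
by rewrite mulr0 addr0 subrr.
Qed.

(** As [D m] and [D 0] commute, [D 0 (D m x) = 0] says that [D m] kills [D 0 x]. Then [D 0] kills
    [D 0 x], and hence [x]. *)
Lemma frob_peel s b :
  (forall m x, m \in s -> D m x = 0 -> D 0 x = 0) ->
  D 0 (foldr D b s) = 0 -> D 0 b = 0.
Proof.
elim: s => //= m s IHs Ws D0.
apply: IHs => [i x si|]; first by apply: Ws; rewrite inE si orbT.
apply/inner_derivation_square/(Ws m); first by rewrite inE eqxx.
rewrite -{}D0 /D expr1 !mulrBl !mulrBr !mulrA -exprS -exprSr !opprB.
by rewrite !addrA [LHS]addrAC [RHS]addrAC; congr (_ + _); rewrite addrAC.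
Qed.

Lemma frob_commute b :
  (forall m x, (0 < m < k)%N -> x * a = a ^+ (p ^ m) * x -> x * a = a * x) ->
  b * a = a * b.
Proof.
move=> W; have := frob_prod_annihilates b.
rewrite -(prednK k_gt0) /= => /frob_peel.
rewrite /D expr1 => peel; apply/subr0_eq/peel => m x.
rewrite mem_iota add1n prednK // => /W Wm /subr0_eq/Wm ->; exact: subrr.
Qed.

End FrobeniusProduct.

(* Multiplying by the idempotents of the loci [c j = i], [i : 'F_p], turns the
   coefficients [c j] into scalars. *)
Lemma split_fixed_coefs a (c : nat -> A) n y : (forall j, c j ^+ p = c j) ->
  (forall e (g : {poly 'F_p}), (forall x, e * x = x * e) -> (size g <= n)%N ->
     e * (\sum_(j < n) c j * a ^+ j) = e * horner_alg a g -> e * y = 0) ->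
  y = 0.
Proof.
move=> cp; elim: n y => [|n IHn] y Hy.
  rewrite -[y]mul1r; apply: (Hy 1 0); rewrite ?size_poly0 ?big_ord0 ?rmorph0 //.
  by move=> x; rewrite mulr1 mul1r.
apply: IHn => e g ec sg eg; apply: (fixed_cases (cp n)) => i.
have [_ ec' de] := fixed_idempotent (fixed_shift i (cp n)).
set d := c n - _ in ec' de *; set e' := 1 - _ in ec' de *.
(* On [e'] the coefficient [c n] is the scalar [i], which becomes the coefficient of ['X^n]. *)
rewrite mulrA; apply: (Hy _ (g + i *: 'X^n)) => [x||].
- by rewrite -mulrA ec !mulrA ec'.
- rewrite (leq_trans (size_polyD _ _)) // geq_max leqW //=.
  by rewrite (leq_trans (size_scale_leq _ _)) // size_polyXn.
rewrite big_ord_recr /= -!mulrA !(mulrDr e) eg rmorphD /= linearZ /=.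
rewrite rmorphXn /= horner_algX !mulrDr; congr (_ + _).
apply/subr0_eq; rewrite -!mulrBr -mulrBl -/d.
by rewrite (mulrA e) (ec d) -(mulrA d) (mulrA e') (ec' d) de mul0r.
Qed.

Lemma frob_of_low_degree a b m :
  (forall (f : {poly 'F_p}) x, (size f <= k)%N ->
     x * a = horner_alg a f * x -> x * a = a * x) ->
  b * a = a ^+ (p ^ m) * b -> b * a = a * b.
Proof.
move=> W ba; apply/subr0_eq.
apply: (split_fixed_coefs (frob_prod_coef_fixed a) (a := a) (n := k)).
move=> e g ec sg eg.
(* On [e], [g] stands for the terms of the product below degree [k]; adding the leading term gives a
   monic polynomial over ['F_p] that [a] satisfies there. *)
pose h := 'X^k + g.
have sh : size h = k.+1 by rewrite size_polyDl size_polyXn.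
have evh : e * horner_alg a h = 0.
  rewrite rmorphD /= mulrDr -eg -mulrDr rmorphXn /= horner_algX.
  rewrite -[RHS](mulr0 e); congr (e * _).
  have sH : size (frob_prod (iota 0 k)) = k.+1.
    by rewrite size_prod_XsubC size_iota.
  have /monicP := monic_prod_XsubC (iota 0 k) xpredT
    (fun m => 'X^(p ^ m) : {poly 'F_p}).
  rewrite lead_coefE -/(frob_prod _) sH /= => lH.
  rewrite -[RHS](frob_prod_root a) (horner_coef_wide (n := k.+1)); last first.
    by rewrite -sH; apply: size_poly.
  rewrite big_ord_recr /= coef_map /= lH rmorph1 mul1r addrC; congr (_ + _).
  by apply: eq_bigr => j _; rewrite coef_map.
pose f := 'X^(p ^ m) %% h.
have evf : e * a ^+ (p ^ m) = e * horner_alg a f.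
  rewrite -[a in LHS](horner_algX a) -rmorphXn (divp_eq 'X^(p ^ m) h) rmorphD.
  by rewrite rmorphM /= mulrDr mulrA ec -mulrA evh mulr0 add0r.
(* Since [e] is central, [f] can replace ['X^(p ^ m)] in the relation for [e * b]. *)
have : e * b * a = a * (e * b).
  apply: (W f); first by rewrite -ltnS -sh ltn_modp -size_poly_eq0 sh.
  by rewrite -mulrA ba !mulrA evf (ec (horner_alg a f)).
by move=> eba; rewrite mulrBr mulrA eba !mulrA (ec a) subrr.
Qed.

End PowerRing.

(** * Models of algebraic theories *)

Section Evaluation.
Variables (S : signature) (X : Type).
Variable interp : forall o : op S, ('I_(arity o) -> X) -> X.

Fixpoint eval n (v : 'I_n -> X) (t : term S n) : X :=
  match t with
  | Var i => v i
  | App o args => interp (fun i => eval v (args i))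
  end.

Lemma eval_subst n m (s : term S n) (u : 'I_n -> term S m) v :
  eval v (subst s u) = eval (fun i => eval v (u i)) s.
Proof. by elim: s => //= o args IH; congr interp; apply/funext. Qed.

End Evaluation.

Section Soundness.
Variables (T : theory) (X : Type).
Variable interp : forall o : op (sig_of T), ('I_(arity o) -> X) -> X.
Local Notation eval := (eval interp).

Lemma provable_sound :
  (forall n (s t : term (sig_of T) n),
     axiom s t -> forall v, eval v s = eval v t) ->
  forall n (s t : term (sig_of T) n),
    provable s t -> forall v, eval v s = eval v t.
Proof.
move=> ax n s t; elim=> {n s t} //=.
- by move=> n s t u _ IHs _ IHt v; rewrite IHs IHt.
- move=> r n u s t _ IH v; rewrite !eval_subst; congr (eval _ u).
  by apply/funext => i; apply: IH.
- by move=> r n s t u _ IH v; rewrite !eval_subst IH.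
Qed.

End Soundness.

Section TermModel.
Variables (T : theory) (n : nat).

(** Classical equality and choice on terms, needed to form the quotient. *)
HB.instance Definition _ S := gen_eqMixin (term S n).
HB.instance Definition _ S := gen_choiceMixin (term S n).

Definition provableb (s t : term (sig_of T) n) : bool := `[< provable s t >].

Lemma provableb_refl : reflexive provableb.
Proof. by move=> s; apply/asboolP/pr_refl. Qed.

Lemma provableb_sym : symmetric provableb.
Proof. by move=> s t; apply: asbool_equiv_eq; split; apply: pr_sym. Qed.

Lemma provableb_trans : transitive provableb.
Proof.
by move=> t s u /asboolP st /asboolP tu; apply/asboolP/(pr_trans st).
Qed.

Canonical provable_equiv :=
  EquivRel provableb provableb_refl provableb_sym provableb_trans.

Definition term_model := {eq_quot provable_equiv}.
HB.instance Definition _ := Choice.on term_model.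
HB.instance Definition _ := EqQuotient.on term_model.

Lemma term_modelP (s t : term (sig_of T) n) :
  \pi_term_model s = \pi_term_model t <-> provable s t.
Proof.
split; first by move=> /eqmodP /asboolP.
by move=> st; apply/eqmodP/asboolP.
Qed.

Lemma pi_App (o : op (sig_of T)) (s t : 'I_(arity o) -> term (sig_of T) n) :
  (forall i, \pi_term_model (s i) = \pi_term_model (t i)) ->
  \pi_term_model (App o s) = \pi_term_model (App o t).
Proof.
(* By conversion, [App o s] is the composite of [o] applied to variables with [s], the shape the
   congruence rule asks for. *)
move=> st; apply/term_modelP; apply: (pr_congr (App o (fun i => Var i))) => i.
exact/term_modelP.
Qed.

Lemma pi_subst m (s t : term (sig_of T) m) (u : 'I_m -> term (sig_of T) n) :
  provable s t -> \pi_term_model (subst s u) = \pi_term_model (subst t u).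
Proof. by move=> st; apply/term_modelP/pr_subst. Qed.

End TermModel.

(** * Substitution in ring terms *)

Section RingTermSubst.
Variables (C : Type) (n m : nat) (u : 'I_n -> term (ring_sig C) m).
Implicit Types s t : term (ring_sig C) n.

Lemma subst_add s t : subst (s + t)%rterm u = (subst s u + subst t u)%rterm.
Proof. by congr App; apply/funext => -[[|[|i]] //= ?]. Qed.

Lemma subst_mul s t : subst (s * t)%rterm u = (subst s u * subst t u)%rterm.
Proof. by congr App; apply/funext => -[[|[|i]] //= ?]. Qed.

Lemma subst_opp s : subst (- s)%rterm u = (- subst s u)%rterm.
Proof. by congr App; apply/funext => -[[|i] //= ?]. Qed.

Lemma subst_zero : subst (0 : term (ring_sig C) n)%rterm u = 0%rterm.
Proof. by congr App; apply/funext => -[]. Qed.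

Lemma subst_one : subst (1 : term (ring_sig C) n)%rterm u = 1%rterm.
Proof. by congr App; apply/funext => -[]. Qed.

Lemma subst_exp s i : subst (s ^+ i)%rterm u = (subst s u ^+ i)%rterm.
Proof.
case: i => [|i]; first exact: subst_one.
by rewrite /texp /iterop; elim: i => //= i <-; apply: subst_mul.
Qed.

Lemma subst_nat i : subst (tnat i) u = tnat i.
Proof.
case: i => [|i]; first exact: subst_zero.
rewrite /tnat /iterop; elim: i => [|i IHi] /=; first exact: subst_one.
by apply: etrans (subst_add _ _) _; rewrite IHi subst_one.
Qed.

End RingTermSubst.


(** * The ring of terms modulo provable equality *)

Section PkRingModel.
Variables p k n : nat.
Local Notation tm := (term (ring_sig void) n).

(** The free ring of this theory on [n] generators. *)
Definition pk_model := @term_model (pkring_theory p k) n.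
HB.instance Definition _ := Choice.on pk_model.
HB.instance Definition _ := EqQuotient.on pk_model.
Implicit Types x y z : pk_model.

Definition pk_class (t : tm) : pk_model := \pi_pk_model t.

Lemma pk_classP (s t : tm) :
  pk_class s = pk_class t <-> provable (T := pkring_theory p k) s t.
Proof. exact: term_modelP. Qed.

Lemma pk_class_surj x : exists t, x = pk_class t.
Proof. by exists (repr x); rewrite /pk_class reprK. Qed.

Definition pk_add x y : pk_model := pk_class (repr x + repr y)%rterm.
Definition pk_mul x y : pk_model := pk_class (repr x * repr y)%rterm.
Definition pk_opp x : pk_model := pk_class (- repr x)%rterm.
Definition pk_zero : pk_model := pk_class 0%rterm.
Definition pk_one : pk_model := pk_class 1%rterm.

Lemma pk_class_add s t :
  pk_class (s + t)%rterm = pk_add (pk_class s) (pk_class t).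
Proof. by apply: pi_App => -[[|[|i]] //= ?]; apply/esym/reprK. Qed.

Lemma pk_class_mul s t :
  pk_class (s * t)%rterm = pk_mul (pk_class s) (pk_class t).
Proof. by apply: pi_App => -[[|[|i]] //= ?]; apply/esym/reprK. Qed.

Lemma pk_class_opp s : pk_class (- s)%rterm = pk_opp (pk_class s).
Proof. by apply: pi_App => -[[|i] //= ?]; apply/esym/reprK. Qed.

Lemma pk_class_axiom m (s t : term (ring_sig void) m) (u : 'I_m -> tm) :
  pkring_axiom p k s t -> pk_class (subst s u) = pk_class (subst t u).
Proof. by move=> st; apply: pi_subst; apply: pr_axiom. Qed.

Let u3 (r s t : tm) := tnth [tuple r; s; t].

Lemma pk_addA : associative pk_add.
Proof.
move=> x y z; case: (pk_class_surj x) (pk_class_surj y) (pk_class_surj z).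
move=> r -> [s ->] [t ->].
have := pk_class_axiom (u3 r s t) (ax_ring _ _ (ax_addA _)).
by rewrite !subst_add !pk_class_add.
Qed.

Lemma pk_mulA : associative pk_mul.
Proof.
move=> x y z; case: (pk_class_surj x) (pk_class_surj y) (pk_class_surj z).
move=> r -> [s ->] [t ->].
have := pk_class_axiom (u3 r s t) (ax_ring _ _ (ax_mulA _)).
by rewrite !subst_mul !pk_class_mul.
Qed.

Lemma pk_mulDl : left_distributive pk_mul pk_add.
Proof.
move=> x y z; case: (pk_class_surj x) (pk_class_surj y) (pk_class_surj z).
move=> r -> [s ->] [t ->].
have := pk_class_axiom (u3 r s t) (ax_ring _ _ (ax_mulDl _)).
by rewrite !(subst_mul, subst_add) !(pk_class_mul, pk_class_add).
Qed.

Lemma pk_mulDr : right_distributive pk_mul pk_add.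
Proof.
move=> x y z; case: (pk_class_surj x) (pk_class_surj y) (pk_class_surj z).
move=> r -> [s ->] [t ->].
have := pk_class_axiom (u3 r s t) (ax_ring _ _ (ax_mulDr _)).
by rewrite !(subst_mul, subst_add) !(pk_class_mul, pk_class_add).
Qed.

Lemma pk_addC : commutative pk_add.
Proof.
move=> x y; case: (pk_class_surj x) (pk_class_surj y) => s -> [t ->].
have := pk_class_axiom (tnth [tuple s; t]) (ax_ring _ _ (ax_addC _)).
by rewrite !subst_add !pk_class_add.
Qed.

Lemma pk_add0 : left_id pk_zero pk_add.
Proof.
move=> x; case: (pk_class_surj x) => t ->.
have := pk_class_axiom (fun=> t) (ax_ring _ _ (ax_add0 _)).
by rewrite subst_add subst_zero pk_class_add.
Qed.

Lemma pk_addN : left_inverse pk_zero pk_opp pk_add.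
Proof.
move=> x; case: (pk_class_surj x) => t ->.
have := pk_class_axiom (fun=> t) (ax_ring _ _ (ax_addN _)).
by rewrite subst_add subst_opp subst_zero pk_class_add pk_class_opp.
Qed.

Lemma pk_mul1 : left_id pk_one pk_mul.
Proof.
move=> x; case: (pk_class_surj x) => t ->.
have := pk_class_axiom (fun=> t) (ax_ring _ _ (ax_mul1l _)).
by rewrite subst_mul subst_one pk_class_mul.
Qed.

Lemma pk_mulr1 : right_id pk_one pk_mul.
Proof.
move=> x; case: (pk_class_surj x) => t ->.
have := pk_class_axiom (fun=> t) (ax_ring _ _ (ax_mul1r _)).
by rewrite subst_mul subst_one pk_class_mul.
Qed.

HB.instance Definition _ :=
  GRing.isZmodule.Build pk_model pk_addA pk_addC pk_add0 pk_addN.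
HB.instance Definition _ := GRing.Zmodule_isPzRing.Build pk_model
  pk_mulA pk_mul1 pk_mulr1 pk_mulDl pk_mulDr.

Lemma pk_class_exp t i : pk_class (t ^+ i)%rterm = (pk_class t ^+ i)%R.
Proof.
(* [iterop] ends the product with the base itself and no unit; [exprSr] isolates that last
   factor. *)
case: i => [//|i]; rewrite /texp /iterop exprSr.
elim: i => [|i IHi] /=; first by rewrite expr0 mul1r.
by apply: etrans (pk_class_mul _ _) _; rewrite IHi exprS -mulrA.
Qed.

Lemma pk_class_nat i : pk_class (tnat i) = (i%:R)%R.
Proof.
case: i => [//|i]; rewrite /tnat /iterop.
elim: i => [//|i IHi] /=.
by apply: etrans (pk_class_add _ _) _; rewrite IHi [RHS]mulrS.
Qed.

Lemma pk_model_exp x : (x ^+ (p ^ k) = x)%R.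
Proof.
case: (pk_class_surj x) => t ->.
have := pk_class_axiom (fun=> t) (ax_pow _ p k).
by rewrite subst_exp pk_class_exp.
Qed.

Lemma pk_model_char : (p%:R = 0 :> pk_model)%R.
Proof.
have := pk_class_axiom (tnth [tuple]) (ax_char _ p k).
by rewrite subst_nat pk_class_nat subst_zero.
Qed.

End PkRingModel.

(** * Interpreting ring terms *)

Section RingInterpretation.
Variables (R : pzRingType) (C : Type) (const : C -> R).

Definition ring_interp (o : op (ring_sig C)) : ('I_(arity o) -> R) -> R :=
  match o with
  | Add => fun w => w ord0 + w (@Ordinal 2 1 isT)
  | Opp => fun w => - w ord0
  | Zero => fun=> 0
  | Mul => fun w => w ord0 * w (@Ordinal 2 1 isT)
  | One => fun=> 1
  | Const c => fun=> const c
  end.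

Variables (n : nat) (v : 'I_n -> R).
Local Notation ev := (eval ring_interp v).
Implicit Types s t : term (ring_sig C) n.

Lemma eval_add s t : ev (s + t)%rterm = ev s + ev t.
Proof. by []. Qed.

Lemma eval_mul s t : ev (s * t)%rterm = ev s * ev t.
Proof. by []. Qed.

Lemma eval_exp s i : ev (s ^+ i)%rterm = ev s ^+ i.
Proof.
case: i => [//|i]; rewrite /texp /iterop exprSr.
elim: i => [|i IHi]; first by rewrite expr0 mul1r.
apply: etrans (eval_mul s _) _.
by rewrite [X in _ * X]IHi exprS -mulrA.
Qed.

Lemma eval_nat i : ev (tnat i) = i%:R.
Proof.
case: i => [//|i]; rewrite /tnat /iterop.
elim: i => [//|i IHi].
apply: etrans (eval_add 1%rterm _) _.
by rewrite [X in _ + X]IHi [RHS]mulrS.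
Qed.

End RingInterpretation.

Lemma eval_poly p (A : algType 'F_p) C (const : C -> A) n (v : 'I_n -> A) f s :
  eval (ring_interp const) v (tpoly f s) =
  horner_alg (eval (ring_interp const) v s) f.
Proof.
have ev0 : eval (ring_interp const) v 0%rterm = 0 by [].
rewrite (big_morph _ (eval_add const v) ev0).
rewrite -[f in RHS]coefK poly_def linear_sum; apply: eq_bigr => i _.
rewrite eval_mul eval_nat eval_exp linearZ /= rmorphXn /= horner_algX.
(* The natural number representing a coefficient maps back to it in ['F_p]. *)
by rewrite -{2}[f`_i]natr_Zp mulr_algl scaler_nat mulr_natl.
Qed.

Lemma pkring_axiom_sound (R : pzRingType) (C : Type) (const : C -> R) p k :
  (forall x : R, x ^+ (p ^ k) = x) -> p%:R = 0 :> R ->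
  forall n (s t : term (ring_sig C) n), pkring_axiom p k s t ->
  forall v, eval (ring_interp const) v s = eval (ring_interp const) v t.
Proof.
move=> powR charR n s t [{}n {}s {}t [] v| v | v] /=.
- exact: addrA.
- exact: addrC.
- exact: add0r.
- exact: addNr.
- exact: mulrA.
- exact: mul1r.
- exact: mulr1.
- exact: mulrDl.
- exact: mulrDr.
- by rewrite eval_exp powR.
- by rewrite eval_nat charR.
Qed.

Lemma W_provable_sound p k (A : algType 'F_p) (f : {poly 'F_p}) (a b : A) :
  prime p -> (forall x : A, x ^+ (p ^ k) = x) -> W_provable p k f ->
  b * a = horner_alg a f * b -> b * a = a * b.
Proof.
move=> p_pr powA W ba.
pose const c := if c is Wa then a else b.
apply: (@provable_sound (W_theory k f) A (ring_interp const)
  _ 0 _ _ W (fun=> 0)).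
move=> n s t [{}n {}s {}t /pkring_axiom_sound st v | v].
  by apply: st; rewrite ?(pcharf0 (pcharA A p_pr)).
by rewrite !eval_mul eval_poly.
Qed.

(** In the free ring on two generators, equality of the classes of [x2 * y2] and [y2 * x2] is
    provability itself. *)
Lemma commutativity_provable_of_rings p k : prime p ->
  (forall A : algType 'F_p, (forall x : A, x ^+ (p ^ k) = x) ->
     forall x y : A, x * y = y * x) ->
  commutativity_provable p k.
Proof.
move=> p_pr comm; apply/pk_classP.
(* A trivial model is treated apart, since the ['F_p]-algebra is built on a nonzero ring. *)
have [one0 | one_neq0] := eqVneq (1 : pk_model p k 2) 0.
  by rewrite -[LHS]mulr1 -[RHS]mulr1 one0 !mulr0.
pose R : nzRingType := HB.pack (pk_model p k 2)
  (GRing.PzSemiRing_isNonZero.Build (pk_model p k 2) one_neq0).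
have pcharR : p \in [pchar R] by rewrite inE p_pr; apply/eqP/pk_model_char.
rewrite !pk_class_mul.
exact: (comm (pPrimeCharType pcharR) (@pk_model_exp p k 2)).
Qed.

Local Close Scope ring_scope.
Local Close Scope quotient_scope.

Theorem theorem1p6 (p k : nat) (hp : prime p) (hk : 1 <= k) :
  ((forall m : nat, 1 <= m < k -> W_provable p k ('X^(p ^ m))%R) ->
     commutativity_provable p k) /\
  ((forall f : {poly 'F_p}, size f <= k -> W_provable p k f) ->
     commutativity_provable p k).
Proof.
split=> W; apply: (commutativity_provable_of_rings hp) => A powA y x.
  apply/esym/(frob_commute hp hk powA) => m b mk ba.
  apply: (W_provable_sound hp powA (W m mk)).
  by rewrite rmorphXn /= horner_algX.
apply/esym/(frob_commute hp hk powA) => m b _.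
apply: (frob_of_low_degree hp hk powA) => f z sf.
exact: (W_provable_sound hp powA (W f sf)).
Qed.
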